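(* Let $R$ be a fiber product ring and let $M$ be a finitely generated $R$-module. If $\operatorname{Ext}^i_R(M,M\oplus R)=0$ for $1\le i\le 6$, then $M$ is free.
   Context: All local rings are commutative and Noetherian. A local ring $(R,\mathfrak m,k)$ is a fiber product ring if $R\cong S\times_k T=\{(s,t)\in S\times T : \pi_S(s)=\pi_T(t)\}$, where $S,T$ are local rings with the same residue field $k$, neither of them equal to $k$, and $\pi_S,\pi_T$ are the reductions modulo the maximal ideals. Equivalently, $\mathfrak m=I\oplus J$ for nonzero ideals $I,J$ of $R$. *)

(* Defs.v *)
From HB Require Import structures.
From mathcomp Require Import all_boot all_algebra.

Set Implicit Arguments.
Unset Strict Implicit.
Unset Printing Implicit Defensive.

Import GRing.Theory.
Local Open Scope ring_scope.

Definition surjective (A B : Type) (f : A -> B) : Prop :=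
  forall y, exists x, f x = y.

(** ** Finitely generated and free modules *)

Definition fg_submodule (R : comNzRingType) (V : lmodType R) (U : {pred V}) :
    Prop :=
  exists (n : nat) (g : 'I_n -> V), forall x : V,
    x \in U <-> exists c : 'I_n -> R, x = \sum_(i < n) c i *: g i.

Definition fg_module (R : comNzRingType) (M : lmodType R) : Prop :=
  fg_submodule (predT : {pred M}).

Definition free_module (R : comNzRingType) (M : lmodType R) : Prop :=
  exists (n : nat) (f : {linear 'rV[R]_n -> M}), bijective f.

(** ** Local rings *)

(* Ideals of [R] are the submodules of [R^o]; [idealr_closed] is the library's
   notion of ideal, which includes properness. *)
Definition noetherian (R : comNzRingType) : Prop :=
  forall I : {pred R^o}, submod_closed I -> fg_submodule I.

Definition maximal_ideal (R : comNzRingType) (m : {pred R}) : Prop :=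
  idealr_closed m /\
  forall I : {pred R}, idealr_closed I -> {subset m <= I} -> {subset I <= m}.

Definition local_ring (R : comNzRingType) : Prop :=
  noetherian R /\
  exists2 m : {pred R}, maximal_ideal m &
    forall m' : {pred R}, maximal_ideal m' -> m' =i m.

(* [p] identifies [k] with the residue field of [S]. *)
Definition residue_map (S : comNzRingType) (k : fieldType)
    (p : {rmorphism S -> k}) : Prop :=
  surjective p /\ maximal_ideal [pred s | p s == 0].

(** ** Fiber products *)

Section FiberProduct.
Variables (S T k : comNzRingType).
Variables (pS : {rmorphism S -> k}) (pT : {rmorphism T -> k}).

Definition fiber_pred : {pred (S * T)%type} := [pred u | pS u.1 == pT u.2].

Fact fiber_subring_closed : subring_closed fiber_pred.
Proof.
split=> [|u v|u v]; rewrite !inE /=.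
- by rewrite !rmorph1.
- by move=> /eqP eu /eqP ev; rewrite !rmorphB eu ev.
- by move=> /eqP eu /eqP ev; rewrite !rmorphM eu ev.
Qed.

HB.instance Definition _ :=
  GRing.isSubringClosed.Build _ fiber_pred fiber_subring_closed.

Record fiber_prod := FiberProd {
  fiber_val :> (S * T)%type;
  fiber_valP : fiber_val \in fiber_pred }.

HB.instance Definition _ := [isSub for fiber_val].
HB.instance Definition _ := [Choice of fiber_prod by <:].
HB.instance Definition _ := [SubChoice_isSubComNzRing of fiber_prod by <:].

End FiberProduct.

Definition fiber_product_ring (R : comNzRingType) : Prop :=
  local_ring R /\
  exists (S T : comNzRingType) (k : fieldType)
         (pS : {rmorphism S -> k}) (pT : {rmorphism T -> k}),
    [/\ local_ring S /\ local_ring T,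
        residue_map pS /\ residue_map pT,
        (* neither [S] nor [T] is equal to [k] *)
        ~ bijective pS /\ ~ bijective pT
      & exists f : {rmorphism R -> fiber_prod pS pT}, bijective f].

(** ** Ext *)

Definition projective (R : comNzRingType) (P : lmodType R) : Prop :=
  forall (A B : lmodType R) (g : {linear A -> B}) (f : {linear P -> B}),
    surjective g -> exists h : {linear P -> A}, forall x, g (h x) = f x.

Definition exact (A B C : nmodType) (f : A -> B) (g : B -> C) : Prop :=
  forall y : B, g y = 0 <-> exists x : A, f x = y.

Record projective_resolution (R : comNzRingType) (M : lmodType R) :=
  ProjectiveResolution {
    res_mod : nat -> lmodType R;
    res_diff : forall n, {linear res_mod n.+1 -> res_mod n};
    res_aug : {linear res_mod 0 -> M};
    res_projective : forall n, projective (res_mod n);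
    res_aug_surj : surjective res_aug;
    res_aug_exact : exact (res_diff 0) res_aug;
    res_diff_exact : forall n, exact (res_diff n.+1) (res_diff n) }.

Arguments res_projective {R M} p n.
Arguments res_aug_surj {R M} p.
Arguments res_aug_exact {R M} p.
Arguments res_diff_exact {R M} p n.

Section ExtDef.
Variables (R : comNzRingType) (M N : lmodType R).
Variable P : projective_resolution M.

Definition hom_cocycle (n : nat) (f : res_mod P n -> N) : Prop :=
  forall x, f (res_diff P n x) = 0.

Definition hom_coboundary (n : nat) : (res_mod P n -> N) -> Prop :=
  match n with
  | 0 => fun f => forall x, f x = 0
  | n'.+1 => fun f => exists g : {linear res_mod P n' -> N},
                        forall x, f x = g (res_diff P n' x)
  end.

Definition hom_cohomology_zero (n : nat) : Prop :=
  forall f : {linear res_mod P n -> N}, hom_cocycle f -> hom_coboundary f.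

End ExtDef.

(* [Ext^n_R(M, N) = 0]; by [ext_zeroP] below, the choice of the projective
   resolution of [M] is irrelevant. *)
Definition ext_zero (R : comNzRingType) (n : nat) (M N : lmodType R) : Prop :=
  exists P : projective_resolution M, hom_cohomology_zero N P n.

Section Lifting.
Variables (R : comNzRingType) (P A B : lmodType R).
Variables (g : {linear A -> B}) (f : {linear P -> B}).

Definition pullback_pred : {pred (P * A)%type} := [pred u | f u.1 == g u.2].

Fact pullback_closed : submod_closed pullback_pred.
Proof.
split=> [|a u v]; rewrite !inE /= ?linear0 //.
by move=> /eqP eu /eqP ev; rewrite !linearP eu ev.
Qed.

HB.instance Definition _ :=
  GRing.isSubmodClosed.Build R (P * A)%type pullback_pred pullback_closed.

Record pullback := Pullback {
  pullback_val :> (P * A)%type;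
  pullback_valP : pullback_val \in pullback_pred }.

HB.instance Definition _ := [isSub for pullback_val].
HB.instance Definition _ := [Choice of pullback by <:].
HB.instance Definition _ := [SubChoice_isSubLmodule of pullback by <:].

Lemma projective_lift (C : nmodType) (q : B -> C) :
  projective P -> exact g q -> (forall x, q (f x) = 0) ->
  exists h : {linear P -> A}, forall x, g (h x) = f x.
Proof.
move=> projP ex_gq qf0.
pose p1 : {linear pullback -> P} := fst \o (val : pullback -> (P * A)%type).
pose p2 : {linear pullback -> A} := snd \o (val : pullback -> (P * A)%type).
have p1_surj : surjective p1.
  move=> x; have [a ga] := (ex_gq (f x)).1 (qf0 x).
  have xaP : (x, a) \in pullback_pred by rewrite inE /= ga.
  by exists (Pullback xaP).
have [s sK] := projP _ _ p1 idfun p1_surj.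
exists (p2 \o s) => x /=.
by have /eqP <- := pullback_valP (s x); congr (f _); apply: sK.
Qed.

End Lifting.

Section Comparison.
Variables (R : comNzRingType) (M : lmodType R).

Lemma res_diffK (P : projective_resolution M) n x :
  res_diff P n (res_diff P n.+1 x) = 0.
Proof. by apply: (res_diff_exact P n _).2; exists x. Qed.

Lemma res_augK (P : projective_resolution M) x :
  res_aug P (res_diff P 0 x) = 0.
Proof. by apply: (res_aug_exact P _).2; exists x. Qed.

Variables P Q : projective_resolution M.

Lemma chain_map0 (P' Q' : projective_resolution M) :
  exists f : {linear res_mod P' 0 -> res_mod Q' 0},
    forall x, res_aug Q' (f x) = res_aug P' x.
Proof. exact: (res_projective P' 0 _ _ _ _ (res_aug_surj Q')). Qed.

Lemma chain_map1 (P' Q' : projective_resolution M)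
    (f : {linear res_mod P' 0 -> res_mod Q' 0}) :
  (forall x, res_aug Q' (f x) = res_aug P' x) ->
  exists f' : {linear res_mod P' 1 -> res_mod Q' 1},
    forall x, res_diff Q' 0 (f' x) = f (res_diff P' 0 x).
Proof.
move=> augf; apply: (projective_lift (f := f \o res_diff P' 0)
  (res_projective P' _) (res_aug_exact Q')) => x /=.
by rewrite augf res_augK.
Qed.

Lemma chain_mapS (P' Q' : projective_resolution M) n
    (f : {linear res_mod P' n -> res_mod Q' n})
    (f' : {linear res_mod P' n.+1 -> res_mod Q' n.+1}) :
  (forall x, res_diff Q' n (f' x) = f (res_diff P' n x)) ->
  exists f'' : {linear res_mod P' n.+2 -> res_mod Q' n.+2},
    forall x, res_diff Q' n.+1 (f'' x) = f' (res_diff P' n.+1 x).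
Proof.
move=> df; apply: (projective_lift (f := f' \o res_diff P' n.+1)
  (res_projective P' _) (res_diff_exact Q' n)) => x /=.
by rewrite df res_diffK linear0.
Qed.

(* The comparison [Q -> P -> Q] up to degree [n.+1], with a homotopy to the
   identity up to degree [n]. *)
Lemma comparison n :
  exists (u : {linear res_mod Q n -> res_mod P n})
         (u' : {linear res_mod Q n.+1 -> res_mod P n.+1})
         (v : {linear res_mod P n -> res_mod Q n})
         (v' : {linear res_mod P n.+1 -> res_mod Q n.+1})
         (h : {linear res_mod Q n -> res_mod Q n.+1}),
    [/\ forall x, res_diff P n (u' x) = u (res_diff Q n x),
        forall x, res_diff Q n (v' x) = v (res_diff P n x),
        forall x, res_diff Q n
                    (x - v' (u' x) - h (res_diff Q n x)) = 0
      & n = 0%N -> forall x, res_diff Q n (h x) = x - v (u x)].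
Proof.
elim: n => [|n [u [u' [v [v' [h [du dv dh _]]]]]]].
  have [u au] := chain_map0 Q P; have [v av] := chain_map0 P Q.
  have [u' du] := chain_map1 au; have [v' dv] := chain_map1 av.
  have [|h dh] := projective_lift (f := idfun \- (v \o u))
    (res_projective Q 0) (res_aug_exact Q).
    by move=> x /=; rewrite linearB /= av au subrr.
  exists u, u', v, v', h; split=> // x.
  by rewrite !linearB /= dh /= dv du subrr.
have [u'' du'] := chain_mapS du; have [v'' dv'] := chain_mapS dv.
have [|h' dh'] := projective_lift
    (f := (idfun \- (v' \o u')) \- (h \o res_diff Q n))
    (res_projective Q n.+1) (res_diff_exact Q n).
  exact: dh.
exists u', u'', v', v'', h'; split=> // x.
by rewrite !linearB /= dh' /= dv' du' res_diffK linear0 subr0 subrr.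
Qed.

Lemma hom_cohomology_zero_indep (N : lmodType R) n :
  hom_cohomology_zero N P n -> hom_cohomology_zero N Q n.
Proof.
case: n => [|n] H0 f fd.
  have [u [u' [v [v' [h [du dv dh /(_ erefl) h0]]]]]] := comparison 0.
  have fv : hom_cocycle (P := P) (f \o v) by move=> x /=; rewrite -dv fd.
  move=> x; have := fd (h x); rewrite h0 linearB /=.
  by have /= -> := H0 (f \o v) fv (u x); rewrite subr0.
have [u [u' [v [v' [h [du dv dh _]]]]]] := comparison n.
have [v'' dv'] := chain_mapS dv.
have fv : hom_cocycle (P := P) (f \o v') by move=> x /=; rewrite -dv' fd.
have [g gE] := H0 (f \o v') fv.
exists ((g \o u) \+ (f \o h)) => x /=.
have [y yE] := (res_diff_exact Q n _).1 (dh x).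
have := fd y; rewrite yE !linearB /= => /eqP.
rewrite subr_eq0 subr_eq => /eqP ->.
by have /= -> := gE (u' x); rewrite du addrC.
Qed.

End Comparison.

Lemma ext_zeroP (R : comNzRingType) (n : nat) (M N : lmodType R)
    (P : projective_resolution M) :
  ext_zero n M N <-> hom_cohomology_zero N P n.
Proof.
split=> [[Q]|]; last by exists P.
exact: hom_cohomology_zero_indep.
Qed.

(* Main.v *)
Require Import Defs.
From HB Require Import structures.
From mathcomp Require Import all_boot all_algebra.
From mathcomp Require Import boolp classical_sets.

Set Implicit Arguments.
Unset Strict Implicit.
Unset Printing Implicit Defensive.

Import GRing.Theory.
Local Open Scope ring_scope.

(** The maximal ideal of [R] is a direct sum [m = I + J] of nonzero ideals, so
    [I J = 0].  Let [... -> F_1 -> F_0 -> M] be a minimal free resolution with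
    differentials [d_n : F_(n+1) -> F_n]; the entries of [d_n] are in [m].  An
    element of [ker d_n] that lies in [m F_(n+1)] splits into a part in
    [I F_(n+1)] and a part in [J F_(n+1)], and both parts are again in
    [ker d_n], because their images are in [I F_n] and [J F_n], whose
    intersection is zero.

    Suppose that [F_2 <> 0].  A minimal generator of the second syzygy
    [N = ker d_0] splits in this way, and one of its parts is itself part of a
    minimal set of generators.  Up to exchanging [I] and [J], this part is an
    element [u = d_1 c] of [I F_1], where [c] has a unit coordinate
    ([second_syzygy_zero]).  Then [J c] is contained in [ker d_1]; choose [j] in
    [J] but not in [m J], and a lift [c'] of [j c] to [F_3].  Comparison of
    coordinates shows that [c'] has a unit coordinate ([minimal_lift]).  Since
    [I J = 0], the submodule [I c'] is contained in [ker d_2]; choose [x] in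
    [I] but not in [m I], and a lift [y] of [x c'] to [F_4], which again has a
    unit coordinate.

    As [Ext^5(M, R) = 0], the [I]-part of that coordinate function, restricted
    to the fifth syzygy [ker d_3], extends to a linear form on [F_4].
    Subtracting it yields a form [B] on [F_4] that maps [ker d_3] to [J], and
    [tau = B(y)] is still a unit.  As [J u = 0], the map
    [z |-> B(z) u] from [F_4] to [N] vanishes on [ker d_3].  The hypotheses
    imply [Ext^4(M, N) = 0] ([extend_to_syzygy]), hence this map is the
    composition of [d_3] with a map from [F_3] to [N].  Evaluation at [y] gives
    [tau u] in [x N], so [u] is in [m N], contrary to its choice
    ([no_fixed_generator]).

    Therefore [F_2 = 0].  Then [Ext^1(M, R) = 0] makes the coordinate functions
    of [F_1] factor through [d_0], whose entries are in [m]; so [F_1 = 0], and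
    [M] is isomorphic to [F_0]. *)

(** * Units of local rings *)

Lemma nonunit_maximal_ideal (R : comNzRingType) (r : R) :
  ~ (exists s, s * r = 1) -> exists2 m : {pred R}, maximal_ideal m & r \in m.
Proof.
move=> r_nunit.
pose rR : R -> Prop := fun u => exists s, u = s * r.
(* The empty set counts as proper, being the union of the empty chain. *)
pose proper (A : R -> Prop) := [/\ ~ A 1,
  forall a u v, A u -> A v -> A (a * u + v)
  & forall u, A u -> A r /\ A 0].
have rR_proper : proper rR.
  split=> [[s s1]|a u v [s ->] [t ->]|u _]; first by apply: r_nunit; exists s.
    by exists (a * s + t); rewrite mulrDl mulrA.
  by split; [exists 1; rewrite mul1r | exists 0; rewrite mul0r].
have [F Fproper Ftot|A [[A1 Alin A0] Amax]] := @Zorn_bigcup R proper.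
  split=> [[X FX X1]|a u v [X FX Xu] [Y FY Yv]|u [X FX Xu]].
  - by have [nX1 _ _] := Fproper X FX.
  - have [_ Xlin _] := Fproper X FX; have [_ Ylin _] := Fproper Y FY.
    by case: (Ftot X Y FX FY) => XY; [exists Y|exists X] => //;
      [apply: Ylin|apply: Xlin] => //; apply: XY.
  - have [_ _ /(_ u Xu)[Xr X0]] := Fproper X FX.
    by split; exists X.
have [Ar Az] : A r /\ A 0.
  apply: contrapT => nAr; apply: Amax rR_proper.
  split=> [|sub]; last first.
    by apply: nAr; apply: (A0 r); apply: sub; exists 1; rewrite mul1r.
  by move=> u Au; case: nAr; apply: A0 Au.
exists (fun u => `[< A u >]); last exact/asboolP.
split=> [|I [I0 I1 Ilin] AI u Iu].
  split; [exact/asboolP|exact/asboolP|].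
  by move=> a u v /asboolP Au /asboolP Av; apply/asboolP/Alin.
apply/asboolP; apply: contrapT => nAu.
have AI' v : A v -> v \in I by move=> Av; apply: AI; apply/asboolP.
apply: (Amax (fun v => v \in I)).
  by split=> [|sub]; [exact: AI' | apply/nAu/sub].
split; first by rewrite (negbTE I1).
  by move=> *; apply: Ilin.
by move=> v _; split=> //; apply: AI'.
Qed.

Lemma local_unit (R : comNzRingType) (m : {pred R}) (r : R) :
  local_ring R -> maximal_ideal m -> r \notin m -> exists s, s * r = 1.
Proof.
move=> [_ [m0 _ m0_uniq]] m_max; apply: contraNP.
move=> /nonunit_maximal_ideal[m' m'_max rm'].
by rewrite (m0_uniq _ m_max) -(m0_uniq _ m'_max).
Qed.

(** * Finite generation *)

(** The linear combination of the family [g] with coefficients the row [c]. *)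
Definition lincomb (R : comNzRingType) (V : lmodType R) n (g : 'I_n -> V)
  (c : 'rV[R]_n) : V := \sum_i c 0 i *: g i.

Section Lincomb.
Variables (R : comNzRingType) (V : lmodType R).

Fact lincomb_is_linear n (g : 'I_n -> V) : linear (lincomb g).
Proof.
move=> a u v; rewrite /lincomb scaler_sumr -big_split /=; apply: eq_bigr => i _.
by rewrite !mxE scalerDl scalerA.
Qed.
HB.instance Definition _ n (g : 'I_n -> V) :=
  GRing.isLinear.Build R 'rV[R]_n V *:%R (lincomb g) (lincomb_is_linear g).

Lemma lincomb_delta n (g : 'I_n -> V) i : lincomb g (delta_mx 0 i) = g i.
Proof.
rewrite /lincomb (bigD1 i) //= !mxE !eqxx scale1r big1 ?addr0 // => j ji.
by rewrite !mxE (negbTE ji) andbF scale0r.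
Qed.

Lemma linear_lincomb n (f : {linear 'rV[R]_n -> V}) c :
  f c = lincomb (fun i => f (delta_mx 0 i)) c.
Proof.
rewrite {1}[c]row_sum_delta linear_sum; apply: eq_bigr => i _.
by rewrite linearZ.
Qed.

Lemma lincomb_rows n k (D : 'M[R]_(n, k)) c :
  lincomb (fun i => row i D) c = c *m D.
Proof. by rewrite mulmx_sum_row. Qed.

End Lincomb.

Lemma row_solutions (R : comNzRingType) p n k (D : 'M[R]_(n, k))
    (W : 'M[R]_(p, k)) :
  (forall i, exists c, row i W = c *m D) -> exists C, W = C *m D.
Proof.
move=> /fin_all_exists[c cE]; exists (\matrix_i c i).
by apply/row_matrixP => i; rewrite row_mul rowK cE.
Qed.

(** A relation with a unit coefficient makes one generator superfluous; once
    there is none left, all coefficients of relations are in [m]. *)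
Lemma minimal_generators (R : comNzRingType) (V : lmodType R) (m : {pred R})
    (K : V -> Prop) n (g : 'I_n -> V) :
  (forall r, r \notin m -> exists s, s * r = 1) ->
  (forall x, K x <-> exists c, x = lincomb g c) ->
  exists p (h : 'I_p -> V), (forall x, K x <-> exists c, x = lincomb h c) /\
    forall c, lincomb h c = 0 -> forall i, c 0 i \in m.
Proof.
move=> m_unit; elim: n => [|n IHn] in g * => gE.
  by exists 0%N, g; split=> // c _ [].
have [g_min|] := pselect (forall c, lincomb g c = 0 -> forall i, c 0 i \in m).
  by exists n.+1, g.
move=> /existsNP[c /not_implyP[c0 /existsNP[i /negP ci]]].
have [s sci] := m_unit _ ci.
have giE : g i = lincomb (fun j => g (lift i j)) (\row_j - (s * c 0 (lift i j))).
  have : s *: lincomb g c = 0 by rewrite c0 scaler0.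
  rewrite /lincomb (bigD1_ord i) //= scalerDr scalerA sci scale1r => /eqP.
  rewrite addr_eq0 => /eqP ->; rewrite scaler_sumr -sumrN.
  apply: eq_bigr => j _.
  by rewrite mxE scalerA scaleNr.
apply: (IHn (fun j => g (lift i j))) => x; rewrite gE; split=> -[d ->].
  exists (d 0 i *: (\row_j - (s * c 0 (lift i j))) + \row_j d 0 (lift i j)).
  rewrite linearD linearZ /= -giE /lincomb (bigD1_ord i) //=; congr (_ + _).
  by apply: eq_bigr => j _; rewrite mxE.
exists (\row_j oapp (d 0) 0 (unlift i j)).
rewrite /lincomb (bigD1_ord i) //= mxE unlift_none /= scale0r add0r.
by apply: eq_bigr => j _; rewrite mxE liftK.
Qed.

Section NoetherianRows.
Variables (R : comNzRingType) (noethR : noetherian R).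

Lemma noetherian_ideal (A : R -> Prop) :
  A 0 -> (forall a u v, A u -> A v -> A (a * u + v)) ->
  exists n (g : 'I_n -> R), forall x : R,
    A x <-> exists c : 'rV[R]_n, x = \sum_i c 0 i * g i.
Proof.
move=> A0 Alin; have [|n [g gE]] := noethR (I := fun x : R^o => `[< A x >]).
  split; first exact/asboolP.
  by move=> a u v /asboolP Au /asboolP Av; apply/asboolP/Alin.
exists n, g => x; split=> [Ax|[c xE]].
  have /gE[c xE] : x \in [eta fun x : R^o => `[< A x >]] by exact/asboolP.
  by exists (\row_i c i); rewrite xE; apply: eq_bigr => i _; rewrite mxE.
by have /gE/asboolP : exists c : 'I_n -> R, x = \sum_(i < n) c i *: (g i : R^o)
  by exists (c 0).
Qed.

(** Submodules of [R^n] are finitely generated: induction on [k] for the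
    vectors supported on the first [k] coordinates. *)
Lemma noetherian_rows n (K : 'rV[R]_n -> Prop) :
  K 0 -> (forall a u v, K u -> K v -> K (a *: u + v)) ->
  exists p (D : 'M[R]_(p, n)), forall v, K v <-> exists c, v = c *m D.
Proof.
move=> K0 Klin.
suff gen k : (k <= n)%N -> exists p (D : 'M[R]_(p, n)), forall v : 'rV[R]_n,
    (K v /\ forall i : 'I_n, (k <= i)%N -> v 0 i = 0) <-> exists c, v = c *m D.
  have [p [D DE]] := gen n (leqnn n); exists p, D => v; rewrite -DE.
  by split=> [Kv|[]//]; split=> // i; rewrite leqNgt ltn_ord.
elim: k => [_|k IHk ltkn].
  exists 0%N, 0 => v; split=> [[_ v0]|[c ->]].
    by exists 0; rewrite mulmx0; apply/rowP => i; rewrite v0 // mxE.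
  by rewrite mulmx0; split=> // i _; rewrite mxE.
have [p [D DE]] := IHk (ltnW ltkn).
pose K' (v : 'rV[R]_n) := K v /\ forall i : 'I_n, (k < i)%N -> v 0 i = 0.
have K'lin a u v : K' u -> K' v -> K' (a *: u + v).
  move=> [Ku u0] [Kv v0]; split=> [|i ki]; first exact: Klin.
  by rewrite !mxE u0 // v0 // mulr0 addr0.
have K'0 : K' 0 by split=> // i _; rewrite mxE.
(* The ideal of the last coordinates is generated by those of some [w i]. *)
pose ik := Ordinal ltkn.
pose A (r : R) := exists2 v, K' v & v 0 ik = r.
have [||q [g gE]] := @noetherian_ideal A.
- by exists 0; rewrite ?mxE.
- move=> a _ _ [u Ku <-] [v Kv <-]; exists (a *: u + v); first exact: K'lin.
  by rewrite !mxE.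
have /fin_all_exists2[w K'w wg] i : exists2 v, K' v & v 0 ik = g i.
  apply/gE; exists (delta_mx 0 i).
  rewrite (bigD1 i) //= !mxE !eqxx mul1r big1 ?addr0 // => j ji.
  by rewrite !mxE (negbTE ji) andbF mul0r.
pose W := \matrix_i w i.
have K'W c : K' (c *m W).
  rewrite mulmx_sum_row; elim/big_ind: _ => [//|u v K'u K'v|i _].
    by rewrite -[u]scale1r; apply: K'lin.
  by rewrite rowK -[_ *: _]addr0; apply: K'lin.
have Wk c : (c *m W) 0 ik = \sum_i c 0 i * g i.
  by rewrite mxE; apply: eq_bigr => i _; rewrite mxE wg.
exists (q + p)%N, (col_mx W D) => v; split=> [K'v|[c ->]].
  have [|d dE] := (gE (v 0 ik)).1; first by exists v.
  have [|c cE] := (DE (v - d *m W)).1.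
    have [Ku u0] : K' (v - d *m W).
      by rewrite addrC -scaleN1r; apply: K'lin.
    split=> // i; rewrite leq_eqVlt => /orP[/eqP ki|]; last exact: u0.
    have -> : i = ik by apply: val_inj.
    by rewrite 2!mxE Wk -dE subrr.
  by exists (row_mx d c); rewrite mul_row_col -cE addrC subrK.
rewrite -[c]hsubmxK mul_row_col -[lsubmx c *m W]scale1r; apply: K'lin => //.
have [Ku u0] := (DE (rsubmx c *m D)).2 (ex_intro _ _ erefl).
by split=> // i ki; apply: u0; apply: ltnW.
Qed.

End NoetherianRows.

(** * Decomposable maximal ideals *)

(** The ideal [m], with unit complement, is the direct sum of two nonzero
    ideals [I] and [J]; the sum is recorded by its two projections [p] and [q],
    which matter only on [m].  Thus [r] lies in [I] when [r \in m] and
    [p r = r]. *)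
Record decomposition (R : comNzRingType) (m : {pred R}) (p q : R -> R) : Prop :=
  Decomposition {
    dec_unit : forall r, r \notin m -> exists s, s * r = 1;
    dec_proper : 1 \notin m;
    dec_0 : 0 \in m;
    dec_lin : forall a r s, r \in m -> s \in m -> a * r + s \in m;
    dec_p_in : forall r, r \in m -> p r \in m;
    dec_q_in : forall r, r \in m -> q r \in m;
    dec_pq : forall r, r \in m -> p r + q r = r;
    dec_p_lin : forall a r s, r \in m -> s \in m ->
      p (a * r + s) = a * p r + p s;
    dec_q_lin : forall a r s, r \in m -> s \in m ->
      q (a * r + s) = a * q r + q s;
    dec_p_q : forall r, r \in m -> p (q r) = 0;
    dec_q_p : forall r, r \in m -> q (p r) = 0;
    dec_p_neq0 : exists2 r, r \in m & p r != 0;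
    dec_q_neq0 : exists2 r, r \in m & q r != 0 }.

Lemma decomposition_sym (R : comNzRingType) (m : {pred R}) p q :
  decomposition m p q -> decomposition m q p.
Proof.
move=> dec; split; case: dec => //.
by move=> ? ? ? ? ? ? dec_pq *; rewrite addrC dec_pq.
Qed.

Section Decomposition.
Variables (R : comNzRingType) (m : {pred R}) (p q : R -> R).
Hypothesis dec : decomposition m p q.

(** All entries of [A] are in [m]. *)
Definition mx_in n k (A : 'M[R]_(n, k)) := forall i j, A i j \in m.

Lemma dec_mul a r : r \in m -> a * r \in m.
Proof. by move=> rm; rewrite -[a * r]addr0 (dec_lin dec) ?(dec_0 dec). Qed.

Lemma dec_add r s : r \in m -> s \in m -> r + s \in m.
Proof. by move=> rm sm; rewrite -[r]mul1r (dec_lin dec). Qed.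

Lemma dec_sum (I : Type) (s : seq I) (F : I -> R) :
  (forall i, F i \in m) -> \sum_(i <- s) F i \in m.
Proof.
by move=> Fm; elim/big_ind: _ => [|//|//]; [apply: dec_0 dec|apply: dec_add].
Qed.

Lemma dec_p0 : p 0 = 0.
Proof.
have := dec_p_lin dec (- 1) (dec_0 dec) (dec_0 dec).
by rewrite mulr0 addr0 mulN1r addNr.
Qed.

Lemma dec_p_mul a r : r \in m -> p (a * r) = a * p r.
Proof.
move=> rm; have := dec_p_lin dec a rm (dec_0 dec).
by rewrite dec_p0 !addr0.
Qed.

Lemma dec_p_sum (I : Type) (s : seq I) (a F : I -> R) :
  (forall i, F i \in m) ->
  p (\sum_(i <- s) a i * F i) = \sum_(i <- s) a i * p (F i).
Proof.
move=> Fm; elim: s => [|i s IHs]; first by rewrite !big_nil dec_p0.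
rewrite !big_cons (dec_p_lin dec) ?IHs // dec_sum // => j.
exact: dec_mul.
Qed.

Lemma dec_p_p r : r \in m -> p (p r) = p r.
Proof.
move=> rm; have rp := dec_p_in dec rm.
by have := dec_pq dec rp; rewrite (dec_q_p dec rm) addr0.
Qed.

Lemma mx_in_mull n k l (B : 'M_(l, n)) (A : 'M_(n, k)) :
  mx_in A -> mx_in (B *m A).
Proof. by move=> Am i j; rewrite mxE dec_sum // => t; rewrite dec_mul. Qed.

Lemma map_mx_p_mull n k l (B : 'M_(l, n)) (A : 'M_(n, k)) :
  mx_in A -> map_mx p (B *m A) = B *m map_mx p A.
Proof.
move=> Am; apply/matrixP => i j; rewrite !mxE dec_p_sum => [|t]; last exact: Am.
by apply: eq_bigr => t _; rewrite mxE.
Qed.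

Lemma map_mx_p0 n k : map_mx p (0 : 'M_(n, k)) = 0.
Proof. by apply/matrixP => i j; rewrite !mxE dec_p0. Qed.

Lemma map_mx_pD n k (A B : 'M_(n, k)) :
  mx_in A -> mx_in B -> map_mx p (A + B) = map_mx p A + map_mx p B.
Proof.
move=> Am Bm; apply/matrixP => i j; rewrite !mxE.
by rewrite -[A i j]mul1r (dec_p_lin dec) // !mul1r.
Qed.

End Decomposition.

Section ProductZero.
Variables (R : comNzRingType) (m : {pred R}) (p q : R -> R).
Hypothesis dec : decomposition m p q.
Let dec' := decomposition_sym dec.

(** [I] and [J] annihilate each other, their product being in [I :&: J]. *)
Lemma dec_mul0 r s : r \in m -> s \in m -> p r * q s = 0.
Proof.
move=> rm sm; have pr := dec_p_in dec rm; have qs := dec_q_in dec sm.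
rewrite -(dec_pq dec (dec_mul dec (p r) qs)) (dec_p_mul dec) // (dec_p_q dec) //.
by rewrite mulr0 add0r mulrC (dec_p_mul dec') // (dec_q_p dec) // mulr0.
Qed.

Lemma map_mx_pq n k (A : 'M_(n, k)) :
  mx_in m A -> map_mx p A + map_mx q A = A.
Proof. by move=> Am; apply/matrixP => i j; rewrite !mxE (dec_pq dec). Qed.

Lemma map_mx_mul0 n k l (A : 'M_(n, k)) (B : 'M_(k, l)) :
  mx_in m A -> mx_in m B -> map_mx p A *m map_mx q B = 0.
Proof.
move=> Am Bm; apply/matrixP => i j; rewrite !mxE big1 // => t _.
by rewrite !mxE dec_mul0.
Qed.

End ProductZero.

Section KernelSplit.
Variables (R : comNzRingType) (m : {pred R}) (p q : R -> R).
Hypothesis dec : decomposition m p q.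
Let dec' := decomposition_sym dec.

(** The kernel of a matrix with entries in [m], once inside [m], is the direct
    sum of its parts in [I] and [J]. *)
Lemma ker_split l n k (w : 'M_(l, n)) (D : 'M_(n, k)) :
  mx_in m w -> mx_in m D -> w *m D = 0 -> map_mx p w *m D = 0.
Proof.
move=> wm Dm wD0; have pwm : mx_in m (map_mx p w).
  by move=> i j; rewrite mxE (dec_p_in dec).
have qwm : mx_in m (map_mx q w).
  by move=> i j; rewrite mxE (dec_p_in dec').
have pD : map_mx q (map_mx p w *m D) = 0.
  by rewrite (map_mx_p_mull dec') // (map_mx_mul0 dec).
have qD : map_mx p (map_mx q w *m D) = 0.
  by rewrite (map_mx_p_mull dec) // (map_mx_mul0 dec').
rewrite -[LHS](map_mx_pq dec) ?pD ?addr0; last exact: (mx_in_mull dec).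
rewrite -[LHS]addr0 -{1}qD -(map_mx_pD dec); try exact: (mx_in_mull dec).
by rewrite -mulmxDl (map_mx_pq dec) // wD0 (map_mx_p0 dec).
Qed.

End KernelSplit.

(** [j] is in [J] but not in [m J]; the elements of [J] are the [q d] with
    [d \in m]. *)
Definition minimal_element (R : comNzRingType) (m : {pred R}) (q : R -> R) j :=
  [/\ j \in m, q j = j &
    forall n (y d : 'I_n -> R), (forall i, y i \in m) -> (forall i, d i \in m) ->
      j <> \sum_i y i * q (d i)].

Lemma minimal_element_neq0 (R : comNzRingType) (m : {pred R}) (q : R -> R) j :
  minimal_element m q j -> j != 0.
Proof.
move=> [_ _ j_min]; apply/eqP => j0.
by apply: (j_min 0%N (fun=> 0) (fun=> 0)); [case|case|rewrite big_ord0].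
Qed.

(** Nakayama's lemma for [J]. *)
Lemma minimal_element_exists (R : comNzRingType) (m : {pred R}) p q :
  noetherian R -> decomposition m p q -> exists j, minimal_element m q j.
Proof.
move=> noethR dec; have dec' := decomposition_sym dec.
pose J r := r \in m /\ q r = r.
have [||n [g gE]] := @noetherian_ideal _ noethR J.
- by split; [apply: dec_0 dec|apply: dec_p0 dec'].
- move=> a u v [um uE] [vm vE]; split; first exact: dec_lin dec _ _ _ _ _.
  by rewrite (dec_q_lin dec) // uE vE.
have [|k [h [hE h_min]]] := @minimal_generators R R^o m J n g (dec_unit dec).
  by move=> x; rewrite gE.
case: k => [|k] in h hE h_min *.
  have [r rm /negP[]] := dec_q_neq0 dec.
  have [|c ->] := (hE (q r)).1; last by rewrite /lincomb big_ord0.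
  by split; [apply: dec_q_in dec _ _|apply: dec_p_p dec' _ _].
have [jm jE] : J (h 0).
  by apply/hE; exists (delta_mx 0 0); rewrite lincomb_delta.
exists (h 0); split=> // l y d ym dm j_sum.
have /fin_all_exists[a aE] i : exists c, q (d i) = lincomb h c.
  by apply/hE; split; [apply: dec_q_in dec _ _|apply: dec_p_p dec' _ _].
have := h_min (delta_mx 0 0 - \sum_i y i *: a i).
have sumE : lincomb h (\sum_i y i *: a i) = h 0.
  rewrite linear_sum /= j_sum; apply: eq_bigr => i _.
  by rewrite linearZ /= -aE.
rewrite linearB /= lincomb_delta sumE.
rewrite subrr => /(_ erefl 0); rewrite !mxE summxE !eqxx => am.
move/negP: (dec_proper dec); apply; rewrite -[1](subrK (\sum_i (y i *: a i) 0 0)).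
apply: (dec_add dec) => //; apply: (dec_sum dec) => i.
by rewrite mxE mulrC (dec_mul dec).
Qed.

(** If [j] is minimal in [J] and [c] has a unit coordinate, then the
    coefficients that express [j c] by vectors with entries in [m] are not all
    in [m]. *)
Lemma minimal_lift (R : comNzRingType) (m : {pred R}) p q n l j (c : 'rV[R]_n) r
    (y : 'rV[R]_l) (D : 'M[R]_(l, n)) :
  decomposition m p q -> minimal_element m q j ->
  c 0 r \notin m -> mx_in m D -> j *: c = y *m D ->
  exists i, y 0 i \notin m.
Proof.
move=> dec [jm jE j_min] /(dec_unit dec)[s sc] Dm jc.
have dec' := decomposition_sym dec.
apply: contrapT => /forallNP ym.
apply: (j_min l (fun i => s * y 0 i) (fun i => D i r)) => // [i|].
  by apply: (dec_mul dec); apply/negPn/negP => /ym.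
have := congr1 (fun v : 'rV_n => s * q (v 0 r)) jc; rewrite !mxE.
rewrite [j * _]mulrC (dec_p_mul dec') // jE mulrA sc mul1r => ->.
by rewrite (dec_p_sum dec') // mulr_sumr; apply: eq_bigr => i _; rewrite mulrA.
Qed.

(** * Minimal free resolutions *)

(** A minimal free resolution of [M] by matrices acting on row vectors.
    Minimality is expressed by the coefficients of every relation lying in
    [m]. *)
Record minimal_resolution (R : comNzRingType) (m : {pred R}) (M : lmodType R) :=
  MinimalResolution {
    rank : nat -> nat;
    diff : forall n, 'M[R]_(rank n.+1, rank n);
    gens : 'I_(rank 0) -> M;
    gens_surj : forall x, exists c, x = lincomb gens c;
    gens_exact : forall v, lincomb gens v = 0 <-> exists c, v = c *m diff 0;
    diff_exact : forall n (v : 'rV_(rank n.+1)),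
      v *m diff n = 0 <-> exists c, v = c *m diff n.+1;
    gens_min : forall v, lincomb gens v = 0 -> forall i, v 0 i \in m;
    diff_min : forall n (v : 'rV_(rank n.+1)), v *m diff n = 0 ->
      forall i, v 0 i \in m }.

Arguments gens {R m M} F i : rename.
Arguments gens_surj {R m M} F x : rename.

Lemma dependent_choice (A : Type) (B : A -> Type) (P : forall a, B a -> Prop) :
  (forall a, exists b, P a b) -> exists f, forall a, P a (f a).
Proof.
by move=> ex; exists (fun a => projT1 (cid (ex a))) => a; apply: projT2.
Qed.

Section Existence.
Variables (R : comNzRingType) (m : {pred R}) (M : lmodType R).
Hypothesis noethR : noetherian R.
Hypothesis m_unit : forall r, r \notin m -> exists s, s * r = 1.

(** The kernel of a linear map on a free module has a minimal set of
    generators, the rows of [D]. *)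
Lemma minimal_syzygies n (V : lmodType R) (f : {linear 'rV[R]_n -> V}) :
  exists p (D : 'M[R]_(p, n)),
    (forall v, f v = 0 <-> exists c, v = c *m D) /\
    (forall c : 'rV_p, c *m D = 0 -> forall i, c 0 i \in m).
Proof.
have [||p [D DE]] := @noetherian_rows _ noethR n (fun v => f v = 0).
- exact: linear0.
- by move=> a u v u0 v0; rewrite linearP /= u0 v0 scaler0 addr0.
have [|k [h [hE h_min]]] := @minimal_generators R _ m (fun v => f v = 0) p
    (fun i => row i D) m_unit.
  by move=> v; rewrite DE; split=> -[c ->]; exists c; rewrite lincomb_rows.
pose H := \matrix_i h i.
have HE c : c *m H = lincomb h c.
  by rewrite -lincomb_rows; apply: eq_bigr => i _; rewrite rowK.
exists k, H; split=> [v|c]; last by rewrite HE; apply: h_min.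
by rewrite hE; split=> -[c ->]; exists c; rewrite HE.
Qed.

Lemma minimal_resolution_exists :
  fg_module M -> inhabited (minimal_resolution m M).
Proof.
move=> [n0 [g0 g0E]].
have [|n [g [gE g_min]]] := @minimal_generators R M m (fun=> True) n0 g0 m_unit.
  move=> x; split=> // _; have [c ->] := (g0E x).1 isT.
  by exists (\row_i c i); apply: eq_bigr => i _; rewrite mxE.
have [k [D0 [D0E D0_min]]] := minimal_syzygies (lincomb g).
(* A stage is a differential with both its ranks; the ranks come first so that
   those of consecutive stages match by computation. *)
pose stage := {a : nat & {b : nat & 'M[R]_(a, b)}}.
have step_ex (s : stage) : exists pD : {p : nat & 'M[R]_(p, tag s)},
    (forall v : 'rV_(tag s), v *m tagged (tagged s) = 0 <->
      exists c, v = c *m tagged pD) /\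
    (forall c : 'rV_(tag pD), c *m tagged pD = 0 -> forall i, c 0 i \in m).
  have [p [D DP]] := minimal_syzygies (mulmxr (tagged (tagged s))).
  by exists (existT _ p D).
have [next nextP] := dependent_choice step_ex.
pose step (s : stage) : stage :=
  existT _ (tag (next s)) (existT _ (tag s) (tagged (next s))).
pose st i := iter i step (existT _ k (existT _ n D0)).
pose rk i := tag (tagged (st i)).
pose D i : 'M[R]_(rk i.+1, rk i) := tagged (tagged (st i)).
exists; apply: (@MinimalResolution R m M rk D g) => [x|v|i v|v|[|i] v].
- exact/gE.
- exact: D0E.
- exact: (nextP (st i)).1.
- exact: g_min.
- exact: D0_min.
- exact: (nextP (st i)).2.
Qed.

End Existence.

(** * Vanishing of Ext in terms of matrices *)

Lemma projective_rows (R : comNzRingType) n : projective 'rV[R]_n.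
Proof.
move=> A B g f g_surj.
have /fin_all_exists[a aE] i : exists x, g x = f (delta_mx 0 i).
  exact: g_surj.
exists (lincomb a) => c; rewrite (linear_lincomb f) linear_sum.
by apply: eq_bigr => i _; rewrite linearZ /= aE.
Qed.

Section Ext.
Variables (R : comNzRingType) (m : {pred R}) (M : lmodType R).
Variable F : minimal_resolution m M.

(** The projective resolution of [M] formed by the free modules of row vectors
    and right multiplication by the matrices [diff F n]. *)
Definition free_resolution : projective_resolution M.
Proof.
refine (@ProjectiveResolution R M (fun n => 'rV[R]_(rank F n))
  (fun n => mulmxr (diff F n)) (lincomb (gens F)) _ _ _ _).
- by move=> n; apply: projective_rows.
- by move=> x; have [c ->] := gens_surj F x; exists c.
- move=> v; split=> [/gens_exact[c ->]|[c <-]]; first by exists c.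
  by apply/gens_exact; exists c.
- move=> n v; split=> [/diff_exact[c ->]|[c <-]]; first by exists c.
  by apply/diff_exact; exists c.
Defined.

(** If [Ext^(i+1)(M, V) = 0] and [N] is a direct summand of [V], with injection
    [f] and projection [f'], then [(i+1)]-cocycles with values in [N] are
    coboundaries. *)
Lemma ext_zero_extend i (V N : lmodType R) (f : {linear N -> V})
    (f' : {linear V -> N}) (k : 'I_(rank F i.+1) -> N) :
  cancel f f' -> ext_zero i.+1 M V ->
  (forall c, lincomb k (c *m diff F i.+1) = 0) ->
  exists h, forall c, lincomb k c = lincomb h (c *m diff F i).
Proof.
move=> fK /(ext_zeroP _ _ free_resolution)/(_ (f \o lincomb k)) /= ext0 k0.
have [|g gE] := ext0; first by move=> c /=; rewrite k0 linear0.
exists (fun j => f' (g (delta_mx 0 j))) => c.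
rewrite -[LHS]fK [f _]gE /= (linear_lincomb g) linear_sum.
by apply: eq_bigr => j _; rewrite linearZ.
Qed.

Lemma lincomb_col n k (C : 'M[R]_(n, k)) j c :
  lincomb (V := R^o) (fun i => C i j) c = (c *m C) 0 j.
Proof. by rewrite mxE; apply: eq_bigr. Qed.

End Ext.

Section ExtVanishing.
Variables (R : comNzRingType) (m : {pred R}) (M : lmodType R).
Variables (F : minimal_resolution m M) (i : nat).
Hypothesis ext0 : ext_zero i.+1 M (M * R^o)%type.

Lemma ext_extend_ring r (C : 'M[R]_(rank F i.+1, r)) :
  diff F i.+1 *m C = 0 -> exists H, C = diff F i *m H.
Proof.
move=> DC0.
suff /fin_all_exists[h hE] j : exists h : 'cV[R]_(rank F i),
    col j C = diff F i *m h.
  exists (\matrix_(s, j) h j s 0); apply/matrixP => t j.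
  have /matrixP/(_ t 0) := hE j; rewrite !mxE => ->.
  by apply: eq_bigr => s _; rewrite mxE.
pose f (x : R^o) : M * R^o := (0, x).
have f_lin : linear f.
  by move=> a u v; apply: injective_projections; rewrite //= scaler0 addr0.
pose fL : {linear R^o -> (M * R^o)%type} :=
  HB.pack f (GRing.isLinear.Build R R^o (M * R^o)%type *:%R f f_lin).
have [//||h hE] := @ext_zero_extend R m M F i _ R^o fL snd (fun t => C t j) _ ext0.
  by move=> c; rewrite lincomb_col -mulmxA DC0 mulmx0 mxE.
exists (\col_s h s); apply/colP => t; have := hE (delta_mx 0 t).
rewrite lincomb_delta mxE => ->; rewrite mxE.
by apply: eq_bigr => s _; rewrite -rowE !mxE.
Qed.

Lemma ext_extend_module (k : 'I_(rank F i.+1) -> M) :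
  (forall c, lincomb k (c *m diff F i.+1) = 0) ->
  exists h, forall c, lincomb k c = lincomb h (c *m diff F i).
Proof.
pose f (x : M) : M * R^o := (x, 0).
have f_lin : linear f.
  by move=> a u v; apply: injective_projections; rewrite //= scaler0 addr0.
pose fL : {linear M -> (M * R^o)%type} :=
  HB.pack f (GRing.isLinear.Build R M (M * R^o)%type *:%R f f_lin).
exact: (@ext_zero_extend R m M F i _ M fL fst).
Qed.

End ExtVanishing.

(** * The argument *)

Section Argument.
Variables (R : comNzRingType) (m : {pred R}) (M : lmodType R).
Variable F : minimal_resolution m M.
Hypothesis ext0 :
  forall i : nat, (1 <= i <= 6)%N -> ext_zero i M (M * R^o)%type.

Local Notation d := (diff F).

Lemma diff_comp n : d n.+1 *m d n = 0.
Proof.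
apply/row_matrixP => i; rewrite row_mul row0; apply/diff_exact.
by exists (delta_mx 0 i); rewrite -rowE.
Qed.

Lemma diff_in n : mx_in m (d n).
Proof.
move=> i j; have -> : d n i j = row i (d n) 0 j by rewrite mxE.
case: n => [|n] in i j *.
  by apply: gens_min; apply/gens_exact; exists (delta_mx 0 i); rewrite -rowE.
by apply: (diff_min (n := n)); rewrite -row_mul diff_comp row0.
Qed.

(** This is the vanishing of [Ext^4(M, N)] for [N] the second syzygy of [M],
    the row space of [d 1]. *)
Lemma extend_to_syzygy (C : 'M[R]_(rank F 4, rank F 1)) :
  d 4 *m C = 0 -> C *m d 0 = 0 -> exists A, C = d 3 *m (A *m d 1).
Proof.
move=> dC Cd.
have [G CG] := ext_extend_ring (ext0 (i := 4) isT) dC.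
have [|H GH] := ext_extend_ring (ext0 (i := 3) isT) (C := G *m d 0).
  by rewrite mulmxA -CG.
(* The cocycle [eps o H], with values in [M], is [k o d 1]; as [F_0] is free,
   [k] lifts to [K], and [H - K o d 1] takes its values in [ker eps]. *)
pose eps := lincomb (gens F).
have epsd c : eps (c *m d 0) = 0 by apply/gens_exact; exists c.
have eps_row r (X : 'M[R]_(r, rank F 0)) c :
    eps (c *m X) = lincomb (fun t => eps (row t X)) c.
  rewrite mulmx_sum_row /eps linear_sum; apply: eq_bigr => t _.
  by rewrite linearZ.
have [|k kE] := ext_extend_module (ext0 (i := 2) isT)
    (k := fun t => eps (row t H)).
  by move=> c; rewrite -eps_row -mulmxA -GH mulmxA epsd.
have /fin_all_exists[K KE] t : exists c, k t = eps c by apply: gens_surj.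
have [L LE] : exists L, H - d 1 *m (\matrix_t K t) = L *m d 0.
  apply: row_solutions => t; apply/gens_exact.
  rewrite -/(eps _) rowE mulmxBr /eps linearB /= -/eps mulmxA !eps_row kE.
  apply/eqP; rewrite subr_eq0; apply/eqP; apply: eq_bigr => s _.
  by rewrite rowK KE.
have [A AE] : exists A, G - d 2 *m L = A *m d 1.
  apply: row_solutions => t; apply/diff_exact.
  rewrite -row_mul mulmxBl -mulmxA -LE mulmxBr mulmxA diff_comp mul0mx subr0.
  by rewrite GH subrr row0.
by exists A; rewrite -AE mulmxBr mulmxA diff_comp mul0mx subr0.
Qed.

(** The image [c *m d 1] is an element of the second syzygy lying in [I F_1];
    the unit coordinate of [c] says that it can be part of a minimal set of
    generators.  There is no such element. *)
Lemma no_fixed_generator p q (c : 'rV[R]_(rank F 2)) r :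
  decomposition m p q -> noetherian R ->
  c 0 r \notin m -> map_mx p (c *m d 1) = c *m d 1 -> False.
Proof.
move=> dec noethR cr cd_fix; have dec' := decomposition_sym dec.
have [j j_min] := minimal_element_exists noethR dec.
have [x x_min] := minimal_element_exists noethR dec'.
have [jm jE _] := j_min; have [xm xE _] := x_min.
have jfix0 k (v : 'rV[R]_k) : mx_in m v -> map_mx p v = v -> j *: v = 0.
  move=> vm vE; apply/rowP => t; rewrite -vE !mxE -jE mulrC.
  exact: (dec_mul0 dec).
have [c' jcE] : exists c', j *: c = c' *m d 2.
  apply/diff_exact; rewrite -scalemxAl jfix0 //.
  exact: (mx_in_mull dec) (@diff_in 1).
have [r' c'r'] := minimal_lift dec j_min cr (@diff_in 2) jcE.
have xj0 : x * j = 0 by rewrite -xE -jE (dec_mul0 dec).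
have [y xcE] : exists y, x *: c' = y *m d 3.
  by apply/diff_exact; rewrite -scalemxAl -jcE scalerA xj0 scale0r.
have [i0 yi0] := minimal_lift dec' x_min c'r' (@diff_in 3) xcE.
(* [B] is the coordinate [i0], corrected by [G] so as to map the fifth
   syzygy to [J]. *)
have [|G GE] := ext_extend_ring (ext0 (i := 5) isT)
    (C := map_mx p (col i0 (d 4))).
  rewrite -(map_mx_p_mull dec) => [|s t]; last by rewrite mxE diff_in.
  by rewrite colE mulmxA diff_comp mul0mx (map_mx_p0 dec).
pose B : 'cV_(rank F 4) := delta_mx i0 0 - G.
have dB : d 4 *m B = map_mx q (col i0 (d 4)).
  rewrite mulmxBr -GE -colE -[X in X - _](map_mx_pq dec) => [|s t].
    by rewrite addrC addKr.
  by rewrite mxE diff_in.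
pose tau := (y *m B) 0 0.
have tau_unit : tau \notin m.
  (* [y G] annihilates [j], because [j y G] is both in [I] and in [J]. *)
  suff yGm : (y *m G) 0 0 \in m.
    apply: contra yi0 => taum; have -> : y 0 i0 = tau + (y *m G) 0 0.
      by rewrite /tau mulmxBr -colE !mxE subrK.
    exact: (dec_add dec).
  apply/negPn/negP => /(dec_unit dec)[s sG].
  have [z jyE] : exists z, j *: y = z *m d 4.
    by apply/diff_exact; rewrite -scalemxAl -xcE scalerA mulrC xj0 scale0r.
  have cm : mx_in m (z *m col i0 (d 4)).
    by apply: (mx_in_mull dec) => t u; rewrite mxE diff_in.
  have jyG : map_mx p (z *m col i0 (d 4)) = j *: (y *m G).
    rewrite (map_mx_p_mull dec) => [|t u]; last by rewrite mxE diff_in.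
    by rewrite GE mulmxA -jyE scalemxAl.
  have pjG : p ((z *m col i0 (d 4)) 0 0) = j * (y *m G) 0 0.
    by have /matrixP/(_ 0 0) := jyG; rewrite mxE [RHS]mxE.
  have jG0 : j * (y *m G) 0 0 = 0.
    rewrite -pjG -(dec_p_p dec) // pjG mulrC (dec_p_mul dec) //.
    by rewrite -jE (dec_p_q dec) // mulr0.
  have /eqP[] := minimal_element_neq0 j_min.
  by rewrite -[j]mulr1 -sG mulrCA jG0 mulr0.
have [||A AE] := @extend_to_syzygy (B *m (c *m d 1)).
- rewrite mulmxA dB -cd_fix (map_mx_mul0 dec') => [//|s t|].
    by rewrite mxE diff_in.
  exact: (mx_in_mull dec) (@diff_in 1).
- by rewrite -!mulmxA diff_comp !mulmx0.
have xyd : tau *: (c *m d 1) = x *: (c' *m A *m d 1).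
  rewrite -[c' *m A *m _]mulmxA [x *: _]scalemxAl xcE -mulmxA -AE mulmxA.
  by rewrite [y *m B]mx11_scalar mul_scalar_mx.
have /diff_min/(_ r) : (tau *: c - x *: (c' *m A)) *m d 1 = 0.
  by rewrite mulmxBl -!scalemxAl xyd subrr.
rewrite !mxE => tcm; have [s sc] := dec_unit dec cr; case/negP: tau_unit.
have -> : tau = s * ((tau * c 0 r - x * (c' *m A) 0 r) + (c' *m A) 0 r * x).
  by rewrite [x * _]mulrC subrK mulrCA sc mulr1.
by apply: (dec_mul dec); apply: (dec_add dec); rewrite ?mxE ?(dec_mul dec).
Qed.

Variables (p q : R -> R).
Hypotheses (dec : decomposition m p q) (noethR : noetherian R).

(** A row of [d 1] is the sum of its parts in [I F_1] and [J F_1], which are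
    again syzygies; one of them has a unit coefficient at that row. *)
Lemma second_syzygy_zero : rank F 2 = 0%N.
Proof.
case b2: (rank F 2) => [|b] //; exfalso.
have r : 'I_(rank F 2) by rewrite b2; exact: ord0.
have dec' := decomposition_sym dec.
have wm : mx_in m (row r (d 1)) by move=> s t; rewrite mxE diff_in.
have wd : row r (d 1) *m d 0 = 0 by rewrite -row_mul diff_comp row0.
have [c cE] : exists c, map_mx p (row r (d 1)) = c *m d 1.
  by apply/diff_exact/(ker_split dec) => //; apply: diff_in.
have [c' c'E] : exists c, map_mx q (row r (d 1)) = c *m d 1.
  by apply/diff_exact/(ker_split dec') => //; apply: diff_in.
have [cr|/negPn cr] := boolP (c 0 r \notin m); last first.
  have [c'r|/negPn c'r] := boolP (c' 0 r \notin m); last first.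
    have /diff_min/(_ r) : (delta_mx 0 r - (c + c')) *m d 1 = 0.
      by rewrite mulmxBl mulmxDl -cE -c'E (map_mx_pq dec) // -rowE subrr.
    rewrite !mxE !eqxx => e; case/negP: (dec_proper dec).
    rewrite -[1](subrK (c 0 r + c' 0 r)).
    by apply: (dec_add dec) => //; apply: (dec_add dec).
  apply: (no_fixed_generator dec' noethR c'r); rewrite -c'E.
  by apply/matrixP => s t; rewrite !mxE (dec_p_p dec') ?diff_in.
apply: (no_fixed_generator dec noethR cr); rewrite -cE.
by apply/matrixP => s t; rewrite !mxE (dec_p_p dec) ?diff_in.
Qed.

Lemma first_syzygy_zero : rank F 1 = 0%N.
Proof.
case b1: (rank F 1) => [|b] //; exfalso.
have r : 'I_(rank F 1) by rewrite b1; exact: ord0.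
have no_row : 'I_(rank F 2) -> False by rewrite second_syzygy_zero => -[].
have d1 : d 1 = 0 by apply/matrixP => i; case: (no_row i).
have [|H HE] := ext_extend_ring (ext0 (i := 1) isT)
  (C := 1%:M : 'M_(rank F 1)).
  by rewrite d1 mul0mx.
have := congr1 (fun X : 'M_(rank F 1) => X r r) HE.
rewrite !mxE eqxx /= mulr1n => e; case/negP: (dec_proper dec).
rewrite e; apply: (dec_sum dec) => t; rewrite mulrC (dec_mul dec) //.
exact: diff_in.
Qed.

Lemma module_free : free_module M.
Proof.
exists (rank F 0), (lincomb (gens F)).
have inj : injective (lincomb (gens F)).
  move=> u v uv; apply/eqP; rewrite -subr_eq0; apply/eqP.
  have /gens_exact[c ->] : lincomb (gens F) (u - v) = 0.
    by rewrite linearB /= uv subrr.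
  have no_row : 'I_(rank F 1) -> False by rewrite first_syzygy_zero => -[].
  by rewrite (_ : c = 0) ?mul0mx //; apply/rowP => i; case: (no_row i).
have [f fE] := choice (gens_surj F).
by exists f => x; [apply: inj|]; apply/esym/fE.
Qed.
End Argument.

(** * Fiber products *)

(** The summands are the kernels of the projections of [R] to [T] and to [S]. *)
Lemma fiber_product_decomposition (R : comNzRingType) :
  fiber_product_ring R -> exists (m : {pred R}) p q, decomposition m p q.
Proof.
move=> [locR [S [T [k [pS [pT [_ [resS resT] [nbS nbT] [f [g fK gK]]]]]]]]].
have [pS_surj _] := resS; have [pT_surj _] := resT.
pose s r := (fiber_val (f r)).1; pose t r := (fiber_val (f r)).2.
have st r : pS (s r) = pT (t r) by apply/eqP/(fiber_valP (f r)).
have eqR r r' : s r = s r' -> t r = t r' -> r = r'.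
  move=> ss tt; apply: (can_inj fK); apply: val_inj.
  exact: injective_projections.
(* The default [0] is irrelevant: [lift] is used on compatible pairs. *)
pose lift (u : S * T) := g (insubd (0 : fiber_prod pS pT) u).
have liftK u : pS u.1 = pT u.2 -> s (lift u) = u.1 /\ t (lift u) = u.2.
  by move=> /eqP uP; rewrite /s /t /lift gK insubdK.
have s_lin a r r' : s (a * r + r') = s a * s r + s r'.
  by rewrite /s rmorphD rmorphM.
have t_lin a r r' : t (a * r + r') = t a * t r + t r'.
  by rewrite /t rmorphD rmorphM.
have [s0 t0] : s 0 = 0 /\ t 0 = 0 by rewrite /s /t rmorph0.
have [s1 t1] : s 1 = 1 /\ t 1 = 1 by rewrite /s /t rmorph1.
pose m := (fun r => pS (s r) == 0) : {pred R}.
have mE r : (r \in m) = (pS (s r) == 0) by [].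
have mT r : (r \in m) = (pT (t r) == 0) by rewrite mE st.
have m_closed : idealr_closed m.
  split=> [||a r r']; first by rewrite mE s0 rmorph0.
    by rewrite mE s1 rmorph1 oner_eq0.
  by rewrite !mE s_lin rmorphD rmorphM => /eqP -> /eqP ->; rewrite mulr0 addr0.
have m_max : maximal_ideal m.
  split=> // I [I0 I1 I_lin] mI r Ir; rewrite mE; apply: contraNT I1 => sr.
  have [u uE] := pS_surj (- (pS (s r))^-1).
  have [v vE] := pT_surj (- (pS (s r))^-1).
  have [|sl _] := liftK (u, v); first by rewrite uE vE.
  have -> : 1 = - lift (u, v) * r + (lift (u, v) * r + 1).
    by rewrite mulNr addKr.
  apply: I_lin => //; apply: mI.
  by rewrite mE s_lin sl s1 rmorphD rmorphM rmorph1 uE mulNr mulVf ?addNr.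
pose p r := lift (s r, 0); pose q r := lift (0, t r).
have pK r : r \in m -> s (p r) = s r /\ t (p r) = 0.
  by rewrite mE => /eqP sr; apply: liftK; rewrite /= rmorph0.
have qK r : r \in m -> s (q r) = 0 /\ t (q r) = t r.
  by rewrite mT => /eqP tr; apply: liftK; rewrite /= rmorph0.
have [m0 m1 m_lin] := m_closed.
have p_in r : r \in m -> p r \in m.
  by move=> rm; rewrite mE (pK r rm).1 -mE.
have q_in r : r \in m -> q r \in m.
  by move=> rm; rewrite mT (qK r rm).2 -mT.
have nonzero (A B : comNzRingType) (pi : {rmorphism A -> B}) :
    surjective pi -> ~ bijective pi -> exists2 a, pi a = 0 & a <> 0.
  move=> pi_surj; apply: contra_notP => /forall2NP no_ker.
  have pi_inj : injective pi.
    move=> a b ab; apply/eqP; rewrite -subr_eq0; apply/eqP.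
    by have [|/contrapT] := no_ker (a - b); rewrite ?rmorphB ?ab ?subrr.
  have [h hE] := choice pi_surj.
  by exists h => [a|//]; apply: pi_inj.
exists m, p, q; split=> //.
- by move=> r; apply: local_unit.
- move=> r rm; have [sp tp] := pK r rm; have [sq tq] := qK r rm.
  rewrite -[p r]mul1r.
  apply: eqR; rewrite ?s_lin ?t_lin ?s1 ?t1 ?sp ?tp ?sq ?tq mul1r ?addr0 //.
  by rewrite add0r.
- move=> a r r' rm r'm; have [sp tp] := pK r rm; have [sp' tp'] := pK r' r'm.
  have [sp2 tp2] := pK _ (m_lin a _ _ rm r'm).
  by apply: eqR;
    rewrite ?s_lin ?t_lin ?sp2 ?tp2 ?sp ?tp ?sp' ?tp' ?s_lin ?mulr0 ?addr0.
- move=> a r r' rm r'm; have [sp tp] := qK r rm; have [sp' tp'] := qK r' r'm.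
  have [sp2 tp2] := qK _ (m_lin a _ _ rm r'm).
  by apply: eqR;
    rewrite ?s_lin ?t_lin ?sp2 ?tp2 ?sp ?tp ?sp' ?tp' ?t_lin ?mulr0 ?addr0.
- move=> r rm; have [sq tq] := qK r rm; have [sp tp] := pK _ (q_in _ rm).
  by apply: eqR; rewrite ?sp ?tp ?sq ?s0 ?t0.
- move=> r rm; have [sq tq] := pK r rm; have [sp tp] := qK _ (p_in _ rm).
  by apply: eqR; rewrite ?sp ?tp ?tq ?s0 ?t0.
- have [a pa a0] := nonzero _ _ pS pS_surj nbS.
  have [|/= sa ta] := liftK (a, 0); first by rewrite /= pa rmorph0.
  have am : lift (a, 0) \in m by rewrite mE sa pa.
  exists (lift (a, 0)) => //; apply/eqP => e; apply: a0.
  by have [sp _] := pK _ am; rewrite -sa -sp e s0.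
- have [a pa a0] := nonzero _ _ pT pT_surj nbT.
  have [|/= sa ta] := liftK (0, a); first by rewrite /= pa rmorph0.
  have am : lift (0, a) \in m by rewrite mT ta pa.
  exists (lift (0, a)) => //; apply/eqP => e; apply: a0.
  by have [_ tq] := qK _ am; rewrite -ta -tq e t0.
Qed.

Local Close Scope ring_scope.

Theorem corollary3p32 (R : comNzRingType) (M : lmodType R) :
  fiber_product_ring R ->
  fg_module M ->
  (forall i : nat, 1 <= i <= 6 -> ext_zero i M (M * R^o)%type) ->
  free_module M.
Proof.
move=> fiberR fgM ext0; have [[noethR _] _] := fiberR.
have [m [p [q dec]]] := fiber_product_decomposition fiberR.
have [F] := minimal_resolution_exists noethR (dec_unit dec) fgM.
exact: module_free F ext0 _ _ dec noethR.
Qed.
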